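(* Assume unit node costs. Let $\alpha\ge1$, $\beta\in(0,1]$ and let $\pi$ be an $(\alpha,\beta)$-approximate greedy policy. Let $\pi^*$ be any adaptive policy (in particular an optimal one). Then for all positive integers $l$ and $k$, $$f_{avg}(\pi_{[l]})\ \ge\ \big(1-e^{-\beta l/(\alpha k)}\big)\,f_{avg}(\pi^*_{[k]}).$$
   Context: Model (multi-seeding with intermediary constraints). $\mathcal G=(\mathcal V,\mathcal E)$ is a finite directed graph; for an arc $e=(u,v)$, $u$ is called the head node of $e$ and influence can pass from $u$ to $v$. Each arc $e$ has an influence probability $\bar w(e)\in[0,1]$ and each node $v$ has a reward $\mathbf r(v)\ge 0$; each seeding costs $1$. A seeding sequence is a finite sequence $y=(v_1,\dots,v_t)$ of nodes (repetitions allowed), $|y|=t$; $a@b$ denotes concatenation. A realization matrix is an array $M=(M(e,j))_{e\in\mathcal E,\,j\ge 1}$ with entries in $\{0,1\}$; $M(e,j)$ is the realization of arc $e$ the $j$-th time $e$ is observed. The random realization matrix $\mathbf M$ has independent entries $\mathbf M(e,j)\sim\mathrm{Bernoulli}(\bar w(e))$. Given $y=(v_1,\dots,v_t)$ and $M$, rounds $\tau=1,\dots,t$ are run on graphs $\mathcal G_\tau=(\mathcal V,\mathcal E_\tau)$, $\mathcal E_1=\mathcal E$: in round $\tau$ the seed $v_\tau$ is activated and an independent-cascade diffusion runs on $\mathcal G_\tau$: each node activated in round $\tau$ observes each of its outgoing arcs $e\in\mathcal E_\tau$ once in that round; if $e$ was observed $k$ times before, its realization is $M(e,k+1)$; if it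 equals $1$, the other endpoint of $e$ becomes activated in round $\tau$. After round $\tau$, for every node activated in round $\tau$ other than $v_\tau$ (an intermediary), all arcs pointing into that node are removed, giving $\mathcal E_{\tau+1}$. The partial matrix $M[y]$ agrees with $M$ on the entries observed during this process and equals ''?'' elsewhere. The objective $f(y,M)=\sum_{v\in S}\mathbf r(v)$, where $S$ is the set of nodes $v$ with $v\in y$ or with some arc $(u,v)$ having an observed entry equal to $1$. An observed history is a pair $(y,\tilde M_y)$ with $\tilde M_y$ a possible value of $\mathbf M[y]$. The expected marginal gain is $\Delta(v\mid y,\tilde M_y)=\mathbb E[f(y@(v),\mathbf M)\mid \mathbf M[y]=\tilde M_y]-f(y,\tilde M_y)$. An adaptive policy $\pi$ (possibly randomized) maps each observed history in a domain $dom(\pi)$ to a node; run under $M$ from the empty sequence, it seeds $v_t=\pi(y_{t-1},M[y_{t-1}])$ while $(y_{t-1},M[y_{t-1}])\in dom(\pi)$; $\pi(M)$ denotes the resulting complete seeding sequence and $f_{avg}(\pi)=\mathbb E[f(\pi(\mathbf M),\mathbf M)]$ (expectation over $\mathbf M$ and the policy's randomness). The level-$k$ truncation $\pi_{[k]}$ has domain $\{(y,\tilde M_y)\in dom(\pi):|y|<k\}$ and agrees with $\pi$ there. A policy $\pi$ is an $(\alpha,\beta)$-approximate greedy policy if for every observed history $(y,\tilde M_y)$ for which some $v$ has $\Delta(v\mid y,\tilde M_y)>0$, with probability at least $\beta$ it selects a node $v$ with $\Delta(v\mid y,\tilde M_y)\ge\frac1\alpha\max_{v'}\Delta(v'\mid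 y,\tilde M_y)$, and it terminates upon observing any history with $\Delta(v\mid y,\tilde M_y)=0$ for all $v\in\mathcal V$. *)

(* Defs.v *)
From Stdlib Require Import Reals ClassicalEpsilon.
From mathcomp Require Import all_boot.

Set Implicit Arguments.
Unset Strict Implicit.
Unset Printing Implicit Defensive.
Local Open Scope R_scope.

Section Model.
(* Directed graph: node type V, arc type E, arc e = (src e, tgt e);
   src e is the head node (influence passes from src e to tgt e). *)
Variables (V E : finType) (src tgt : E -> V).
Variables (w : E -> R) (r : V -> R).

(* realization matrix; M e j is the realization of e at its (j+1)-th
   observation (0-based column index) *)
Definition matrix := E -> nat -> bool.
Definition pmatrix := E -> nat -> option bool.

(* state before a round: current arc set E_tau and number of previous
   observations of each arc *)
Record state := State { st_arcs : {set E}; st_cnt : E -> nat }.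
Definition init_state : state := State [set: E] (fun _ => 0%N).

Definition live (M : matrix) (s : state) (e : E) : bool :=
  (e \in st_arcs s) && M e (st_cnt s e).
Definition live_rel (M : matrix) (s : state) : rel V :=
  fun x z => [exists e, [&& live M s e, src e == x & tgt e == z]].
Definition activated (M : matrix) (s : state) (seed : V) : {set V} :=
  [set x | connect (live_rel M s) seed x].

Definition step (M : matrix) (s : state) (seed : V) : state :=
  let A := activated M s seed in
  State [set e in st_arcs s | ~~ ((tgt e \in A) && (tgt e != seed))]
        (fun e => (st_cnt s e + ((e \in st_arcs s) && (src e \in A)))%N).

Definition run_seq (M : matrix) (y : seq V) : state := foldl (step M) init_state y.

Definition partial (M : matrix) (y : seq V) : pmatrix :=
  fun e j => if (j < st_cnt (run_seq M y) e)%N then Some (M e j) else None.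

Definition influenced (M : matrix) (y : seq V) : {set V} :=
  [set v | (v \in y) ||
     [exists e, (tgt e == v) && has (M e) (iota 0 (st_cnt (run_seq M y) e))]].

Definition f (y : seq V) (M : matrix) : R :=
  \big[Rplus/R0]_(v in influenced M y) r v.

(* ---- probability: only the first N columns are read by processes of at
   most N rounds (each arc is observed at most once per round), so the
   expectation over the i.i.d. Bernoulli matrix is computed on N columns *)
Definition ext N (Mf : {ffun E * 'I_N -> bool}) : matrix :=
  fun e j => match (insub j : option 'I_N) with Some o => Mf (e, o) | None => false end.
Definition weight N (Mf : {ffun E * 'I_N -> bool}) : R :=
  \big[Rmult/R1]_(p : E * 'I_N) (if Mf p then w p.1 else (1 - w p.1)).
Definition Exp N (g : matrix -> R) : R :=
  \big[Rplus/R0]_(Mf : {ffun E * 'I_N -> bool}) (weight Mf * g (ext Mf)).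
Definition ind (P : Prop) : R := if excluded_middle_informative P then R1 else R0.
Definition Pr N (A : matrix -> Prop) : R := Exp N (fun M => ind (A M)).
Definition CondExp N (g : matrix -> R) (A : matrix -> Prop) : R :=
  (Exp N (fun M => g M * ind (A M)) / Pr N A).

(* f(y, M~_y): evaluate f on any completion of the partial matrix *)
Definition complete (Mt : pmatrix) : matrix := fun e j => odflt false (Mt e j).
Definition f_obs (y : seq V) (Mt : pmatrix) : R := f y (complete Mt).

Definition possible (y : seq V) (Mt : pmatrix) : Prop :=
  (0 < Pr (size y) (fun M => partial M y = Mt)).

Definition gain (v : V) (y : seq V) (Mt : pmatrix) : R :=
  (CondExp (size y).+1 (fun M => f (rcons y v) M) (fun M => partial M y = Mt)
   - f_obs y Mt).

Record policy := Policy {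
  pdom : seq V -> pmatrix -> Prop;
  pchoice : seq V -> pmatrix -> V -> R }.

Definition valid_policy (p : policy) : Prop :=
  forall y Mt, pdom p y Mt ->
    (forall v, (0 <= pchoice p y Mt v)) /\
    \big[Rplus/R0]_(v : V) pchoice p y Mt v = R1.

Definition trunc (p : policy) (k : nat) : policy :=
  Policy (fun y Mt => pdom p y Mt /\ (size y < k)%N) (pchoice p).

(* expected (over the policy's randomness) value of f(p(M), M), from the
   current sequence y, running at most [fuel] more steps *)
Fixpoint outcome (p : policy) (fuel : nat) (y : seq V) (M : matrix) : R :=
  match fuel with
  | O => f y M
  | S n =>
      if excluded_middle_informative (pdom p y (partial M y)) then
        \big[Rplus/R0]_(v : V) (pchoice p y (partial M y) v * outcome p n (rcons y v) M)
      else f y M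
  end.

(* f_avg(p_[k]); p_[k] never seeds more than k nodes, so fuel k and k matrix
   columns are exact *)
Definition favg_trunc (p : policy) (k : nat) : R :=
  Exp k (outcome (trunc p k) k [::]).

Definition max_gain (y : seq V) (Mt : pmatrix) : R :=
  \big[Rmax/R0]_(v : V) gain v y Mt.

Definition approx_greedy (alpha beta : R) (p : policy) : Prop :=
  forall y Mt, possible y Mt ->
    ((exists v, (0 < gain v y Mt)) ->
       pdom p y Mt /\
       (beta <= \big[Rplus/R0]_(v : V)
          (if Rle_dec (/ alpha * max_gain y Mt) (gain v y Mt)
           then pchoice p y Mt v else R0)))
    /\ ((forall v, gain v y Mt = R0) -> ~ pdom p y Mt).

End Model.

(* Main.v *)
(** Let h be a history of [pi] after i rounds, with S the set of nodes influenced so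
    far.  The heart of the proof is
      E f(pistar truncated at k) <= E [f(h) + k * max_v gain(v | h)],
    proved by coupling a run of [pi] on a matrix N with a run of [pistar] on a matrix M.
    Appending the seeds of [pistar] to those of [pi] on the same matrix does not work:
    a node can be hit in the round in which it is itself the seed, so that the longer
    run may see fewer coins than [pistar] alone.  Instead, in the run of [pistar] a
    node activated as an intermediary (which happens at most once) takes the coins of
    its outgoing arcs from column 0 of N, i.e. those used by [pi] when it first
    activates this node; seeds use fresh coins.  If the source of e is in S and
    N(e,0) = 1 then the target of e is in S, so [pistar] reaches new nodes outside S
    only along paths avoiding S, whose coins are fresh given h.  A round of [pistar]
    seeding v therefore adds to S at most gain(v | h) in expectation.
    Together with the greedy property this gives
      OPT - a_(i+1) <= (1 - beta / (alpha k)) (OPT - a_i)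
    for a_i the value of [pi] truncated at i. *)

From HB Require Import structures.
Require Import Defs.
From Stdlib Require Import Reals Lra FunctionalExtensionality ClassicalEpsilon.
From mathcomp Require Import all_boot.
Open Scope R_scope.

HB.instance Definition _ := Monoid.isComLaw.Build R R0 Rplus
  (fun x y z => esym (Rplus_assoc x y z)) Rplus_comm Rplus_0_l.
HB.instance Definition _ := Monoid.isComLaw.Build R R1 Rmult
  (fun x y z => esym (Rmult_assoc x y z)) Rmult_comm Rmult_1_l.
HB.instance Definition _ := Monoid.isMulLaw.Build R R0 Rmult Rmult_0_l Rmult_0_r.
HB.instance Definition _ := Monoid.isAddLaw.Build R Rmult Rplus
  Rmult_plus_distr_r Rmult_plus_distr_l.

(** * Finite weighted sums *)

Section FiniteSums.
Set Implicit Arguments.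
Unset Strict Implicit.

Lemma Rsum_le (I : finType) (P : pred I) (F G : I -> R) :
  (forall i, P i -> F i <= G i) ->
  \big[Rplus/R0]_(i | P i) F i <= \big[Rplus/R0]_(i | P i) G i.
Proof.
by move=> h; apply: (big_ind2 Rle) => //; [apply: Rle_refl | apply: Rplus_le_compat].
Qed.

Lemma Rsum_ge0 (I : finType) (P : pred I) (F : I -> R) :
  (forall i, P i -> 0 <= F i) -> 0 <= \big[Rplus/R0]_(i | P i) F i.
Proof.
by move=> h; apply: (big_ind (Rle 0)) => //; [apply: Rle_refl | apply: Rplus_le_le_0_compat].
Qed.

Definition wsum (T : finType) (p : T -> R) (g : T -> R) : R :=
  \big[Rplus/R0]_t (p t * g t).

Lemma wsum_eq (T : finType) (p g h : T -> R) :
  (forall t, g t = h t) -> wsum p g = wsum p h.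
Proof. by move=> e; apply: eq_bigr => t _; rewrite e. Qed.

(** The comparison is asked only where the weight is positive because the greedy property speaks
    only of possible histories. *)
Lemma wsum_le (T : finType) (p g h : T -> R) :
  (forall t, 0 <= p t) -> (forall t, 0 < p t -> g t <= h t) ->
  wsum p g <= wsum p h.
Proof.
move=> p0 le; apply: Rsum_le => t _.
have [pt|pt] := Rle_lt_or_eq_dec _ _ (p0 t).
  exact: Rmult_le_compat_l (p0 t) (le _ pt).
by rewrite -pt !Rmult_0_l; apply: Rle_refl.
Qed.

Lemma wsumD (T : finType) (p g h : T -> R) :
  wsum p (fun t => g t + h t) = wsum p g + wsum p h.
Proof. by rewrite /wsum -big_split /=; apply: eq_bigr => t _; rewrite Rmult_plus_distr_l. Qed.

Lemma wsumZ (T : finType) (p g : T -> R) (a : R) :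
  wsum p (fun t => a * g t) = a * wsum p g.
Proof.
by rewrite /wsum big_distrr /=; apply: eq_bigr => t _; rewrite -!Rmult_assoc (Rmult_comm a).
Qed.

Lemma wsum_cst (T : finType) (p : T -> R) (a : R) :
  wsum p (fun=> 1) = 1 -> wsum p (fun=> a) = a.
Proof.
move=> p1; rewrite -[RHS]Rmult_1_r -p1 -wsumZ.
by apply: wsum_eq => t; rewrite Rmult_1_r.
Qed.

Lemma wsum_sum (T I : finType) (p : T -> R) (g : I -> T -> R) :
  wsum p (fun t => \big[Rplus/R0]_i g i t) = \big[Rplus/R0]_i wsum p (g i).
Proof. by rewrite /wsum exchange_big /=; apply: eq_bigr => t _; rewrite big_distrr. Qed.

Lemma wsum_exchange (T U : finType) (p : T -> R) (q : U -> R) (g : T -> U -> R) :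
  wsum p (fun t => wsum q (g t)) = wsum q (fun u => wsum p (fun t => g t u)).
Proof.
by rewrite wsum_sum; apply: eq_bigr => u _; rewrite -wsumZ.
Qed.

Lemma wsum_pair (T U : finType) (p : T -> R) (q : U -> R) (g : T -> U -> R) :
  wsum p (fun t => wsum q (g t)) =
  wsum (fun z => p z.1 * q z.2) (fun z : T * U => g z.1 z.2).
Proof.
rewrite /wsum; under eq_bigr do rewrite big_distrr /=.
by rewrite pair_big /=; apply: eq_bigr => z _; rewrite Rmult_assoc.
Qed.

End FiniteSums.

(** * Bernoulli rows and matrices: exchange of coins, change of the number of columns *)

Section RandomMatrices.
Set Implicit Arguments.
Unset Strict Implicit.
Variables (E : finType) (w : E -> R).

Definition bern (e : E) (b : bool) : R := if b then w e else 1 - w e.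

Definition row_weight (x : {ffun E -> bool}) : R := \big[Rmult/R1]_e bern e (x e).
Definition row_exp (g : {ffun E -> bool} -> R) : R := wsum row_weight g.

Lemma weightE N (Mf : {ffun E * 'I_N -> bool}) :
  weight w Mf = \big[Rmult/R1]_e \big[Rmult/R1]_(j < N) bern e (Mf (e, j)).
Proof. by rewrite pair_big /=; apply: eq_bigr => -[e j] _. Qed.

Lemma ExpE N g : Exp w N g = wsum (@weight _ w N) (fun Mf => g (ext Mf)).
Proof. by []. Qed.

Lemma ext_lt N (Mf : {ffun E * 'I_N -> bool}) e (j : 'I_N) : ext Mf e j = Mf (e, j).
Proof. by rewrite /ext valK. Qed.

Lemma ext_ge N (Mf : {ffun E * 'I_N -> bool}) e j : (N <= j)%N -> ext Mf e j = false.
Proof. by move=> h; rewrite /ext; case: insubP => // u; rewrite ltnNge h. Qed.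

(* [row_put] and [row_get] exchange the entry (e, c e) of the matrix with the
   coin x e, for every arc e in d. *)
Definition row_put (d : E -> bool) (c : E -> nat) (x : {ffun E -> bool}) (M : matrix E)
  : matrix E := fun e j => if d e && (j == c e) then x e else M e j.
Definition row_get (d : E -> bool) (c : E -> nat) (x : {ffun E -> bool}) (M : matrix E)
  : {ffun E -> bool} := [ffun e => if d e then M e (c e) else x e].

Section Swap.
Variables (N : nat) (d d' : {ffun E -> bool} -> matrix E -> E -> bool).
Variable c : matrix E -> E -> nat.
Let put x M := row_put (d x M) (c M) x M.
Let get x M := row_get (d x M) (c M) x M.
Hypothesis c_lt : forall M e, (c M e < N)%N.
Hypothesis c_put : forall x M e, c (put x M) e = c M e.
Hypothesis d_inv : forall x M e, d' (get x M) (put x M) e = d x M e.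

Let putf x (Mf : {ffun E * 'I_N -> bool}) : {ffun E * 'I_N -> bool} :=
  [ffun q : E * 'I_N => put x (ext Mf) q.1 q.2].

Let ext_putf x Mf : ext (putf x Mf) = put x (ext Mf).
Proof.
apply: functional_extensionality => e; apply: functional_extensionality => j.
case: (ltnP j N) => hj; first by rewrite -[j]/(val (Ordinal hj)) ext_lt ffunE.
rewrite ext_ge // /put /row_put ext_ge //.
by case: eqP => [ej|]; [move: (c_lt (ext Mf) e); rewrite -ej ltnNge hj | rewrite andbF].
Qed.

Let T (z : {ffun E -> bool} * {ffun E * 'I_N -> bool}) := (get z.1 (ext z.2), putf z.1 z.2).

Let T_inj : injective T.
Proof.
pose T' (z : {ffun E -> bool} * {ffun E * 'I_N -> bool}) :=
  (row_get (d' z.1 (ext z.2)) (c (ext z.2)) z.1 (ext z.2),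
   [ffun q : E * 'I_N => row_put (d' z.1 (ext z.2)) (c (ext z.2)) z.1 (ext z.2) q.1 q.2]).
apply: (@can_inj _ _ _ T') => -[x Mf]; rewrite /T' /T /= ext_putf; congr pair.
  apply/ffunP => e; rewrite !ffunE d_inv c_put.
  by rewrite /put /row_put; case: (d x _ e); rewrite /= ?eqxx.
apply/ffunP => -[e j]; rewrite ffunE /= /row_put d_inv c_put /put /row_put /get /row_get ffunE.
case: (d x (ext Mf) e) => /=; last by rewrite ext_lt.
by case: eqP => [<-|_]; rewrite ext_lt.
Qed.

Let T_weight z : row_weight (T z).1 * weight w (T z).2 = row_weight z.1 * weight w z.2.
Proof.
case: z => x Mf; rewrite /T /= !weightE /row_weight -!big_split /=.
apply: eq_bigr => e _; rewrite /get /row_get ffunE.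
case de: (d x (ext Mf) e); last first.
  by congr (_ * _); apply: eq_bigr => j _; rewrite ffunE /= /put /row_put de /= ext_lt.
pose j0 := Ordinal (c_lt (ext Mf) e).
rewrite (bigD1 j0) //= [in RHS](bigD1 j0) //= ffunE /= /put /row_put de eqxx /=.
rewrite -[c (ext Mf) e]/(val j0) ext_lt -!Rmult_assoc (Rmult_comm (bern e (Mf _))).
congr (_ * _); apply: eq_bigr => j jj0; rewrite ffunE /= /put /row_put de /=.
by case: eqP => [ej|_]; [case/eqP: jj0; apply: val_inj | rewrite ext_lt].
Qed.

(** Both exchanged coins of an arc [e] are Bernoulli with parameter [w e], so the exchange keeps the
    weight of each pair. The set [d] may depend on the coins themselves: since [d'] recovers it from
    the exchanged pair and [c] is unchanged, exchanging again inverts the map and the sum can be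
    reindexed. *)
Lemma swap_row (H : {ffun E -> bool} -> matrix E -> R) :
  row_exp (fun x => Exp w N (H x)) =
  row_exp (fun x => Exp w N (fun M => H (row_get (d x M) (c M) x M) (row_put (d x M) (c M) x M))).
Proof.
rewrite /row_exp; under wsum_eq do rewrite ExpE; under [in RHS]wsum_eq do rewrite ExpE.
rewrite !wsum_pair /wsum (reindex_inj T_inj) /=; apply: eq_bigr => z _.
by move: (T_weight z) => /= ->; rewrite ext_putf.
Qed.

End Swap.

(** Group the matrices with [N] columns by their first [n] columns; every further entry contributes
    the factor [w e + (1 - w e) = 1]. *)
Lemma Exp_cols (n N : nat) (g : matrix E -> R) : (n <= N)%N ->
  (forall M M' : matrix E, (forall e j, (j < n)%N -> M e j = M' e j) -> g M = g M') ->
  Exp w N g = Exp w n g.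
Proof.
move=> nN loc; rewrite !ExpE /wsum.
pose res (Mf : {ffun E * 'I_N -> bool}) : {ffun E * 'I_n -> bool} :=
  [ffun q => Mf (q.1, widen_ord nN q.2)].
have gres Mf : g (ext Mf) = g (ext (res Mf)).
  apply: loc => e j jn; rewrite -[j in RHS]/(val (Ordinal jn)) ext_lt ffunE /=.
  by rewrite -(ext_lt Mf).
rewrite (partition_big res predT) //=; apply: eq_bigr => Mg _.
under eq_bigr => Mf /eqP eMf do rewrite gres eMf.
rewrite -big_distrl /=; congr (_ * _).
(* [Q] prescribes the entries of the first [n] columns and leaves the others free, so the fibre of
   [res] over [Mg] is a product set and the sum of products distributes. *)
pose Q (p : E * 'I_N) : pred bool :=
  fun b => if insub (p.2 : nat) is Some o then b == Mg (p.1, o) else true.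
have -> : \big[Rplus/R0]_(Mf | res Mf == Mg) weight w Mf =
  \big[Rplus/R0]_(Mf in family Q) \big[Rmult/R1]_p bern p.1 (Mf p).
  apply: eq_bigl => Mf; apply/eqP/familyP => [eMf [e j]|hQ].
    rewrite unfold_in /Q /= -eMf; case: insubP => // o _ oj; rewrite ffunE /=; apply/eqP.
    by congr (Mf (e, _)); apply: val_inj.
  apply/ffunP => -[e o]; rewrite ffunE /=.
  by move: (hQ (e, widen_ord nN o)); rewrite unfold_in /Q /= valK => /eqP.
rewrite -(bigA_distr_big_dep Q (fun p b => bern p.1 b)) weightE.
rewrite -(pair_bigA _ (fun e j => \big[Rplus/R0]_(b | Q (e, j) b) bern e b)) /=.
apply: eq_bigr => e _.
transitivity (\big[Rmult/R1]_(j < n) bern e (ext Mg e j)); last first.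
  by apply: eq_bigr => j _; rewrite ext_lt.
rewrite (big_ord_widen N (fun j => bern e (ext Mg e j)) nN) [RHS]big_mkcond /=.
apply: eq_bigr => j _; rewrite /Q /=; case: ltnP => jn.
  by rewrite insubT /= big_pred1_eq -ext_lt.
rewrite insubF ?ltnNge ?jn //.
rewrite (bigID id) /= (big_pred1 true) ?(big_pred1 false) //=; try by case.
  rewrite /bern; lra.
Qed.

End RandomMatrices.

(** * Total mass one and monotonicity of expectations *)

Section Totals.
Set Implicit Arguments.
Unset Strict Implicit.
Variables (E : finType) (w : E -> R).
Hypothesis hw : forall e, 0 <= w e <= 1.

Lemma bern_ge0 e b : 0 <= bern w e b.
Proof. by move: (hw e); rewrite /bern; case: b; lra. Qed.

Lemma prod_ge0 (I : finType) (F : I -> R) :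
  (forall i, 0 <= F i) -> 0 <= \big[Rmult/R1]_i F i.
Proof.
by move=> h; apply: (big_ind (Rle 0)) => //; [apply: Rle_0_1 | apply: Rmult_le_pos].
Qed.

Lemma bern_total e : \big[Rplus/R0]_(b : bool) bern w e b = 1.
Proof. by rewrite big_bool /bern /=; lra. Qed.

Lemma row_weight_ge0 x : 0 <= row_weight w x.
Proof. by apply: prod_ge0 => e; apply: bern_ge0. Qed.

Lemma weight_ge0 N (Mf : {ffun E * 'I_N -> bool}) : 0 <= weight w Mf.
Proof. by apply: prod_ge0 => -[e j]; apply: (bern_ge0 e). Qed.

Lemma row_total : wsum (row_weight w) (fun=> 1) = 1.
Proof.
rewrite /wsum; under eq_bigr do rewrite Rmult_1_r.
by rewrite -(bigA_distr_bigA (bern w)) big1 // => e _; apply: bern_total.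
Qed.

Lemma weight_total N : wsum (@weight _ w N) (fun=> 1) = 1.
Proof.
rewrite /wsum; under eq_bigr do rewrite Rmult_1_r.
rewrite -(bigA_distr_bigA (fun p : E * 'I_N => bern w p.1)) big1 // => -[e j] _.
exact: bern_total.
Qed.

Lemma row_exp_cst a : row_exp w (fun=> a) = a.
Proof. exact: wsum_cst row_total. Qed.

Lemma Exp_cst N a : Exp w N (fun=> a) = a.
Proof. exact: wsum_cst (weight_total N). Qed.

Lemma Exp_le N g h : (forall M, g M <= h M) -> Exp w N g <= Exp w N h.
Proof. by move=> le; apply: wsum_le => // *; apply: weight_ge0. Qed.

Lemma row_exp_le g h : (forall x, g x <= h x) -> row_exp w g <= row_exp w h.
Proof. by move=> le; apply: wsum_le => // *; apply: row_weight_ge0. Qed.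

Lemma row_exp_ge0 g : (forall x, 0 <= g x) -> 0 <= row_exp w g.
Proof. by move=> h; rewrite -(row_exp_cst 0); apply: row_exp_le. Qed.

Lemma Exp_eq N g h : (forall M, g M = h M) -> Exp w N g = Exp w N h.
Proof. by move=> e; apply: wsum_eq. Qed.

Lemma row_exp_eq g h : (forall x, g x = h x) -> row_exp w g = row_exp w h.
Proof. by move=> e; apply: wsum_eq. Qed.

End Totals.

(** * Deterministic properties of the diffusion and of its observed entries *)

Section Process.
Set Implicit Arguments.
Unset Strict Implicit.
Variables (V E : finType) (src tgt : E -> V).

Local Notation run := (run_seq src tgt).
Local Notation obs := (partial src tgt).
Local Notation infl := (influenced src tgt).

Definition reach (L : E -> bool) (v : V) : {set V} :=
  [set x | connect (fun a b => [exists e, [&& L e, src e == a & tgt e == b]]) v x].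

Lemma reach_root L v : v \in reach L v.
Proof. by rewrite inE connect0. Qed.

Lemma reach_step (L : E -> bool) v e : src e \in reach L v -> L e -> tgt e \in reach L v.
Proof.
rewrite !inE => h Le; apply: connect_trans h (connect1 _).
by apply/existsP; exists e; rewrite Le !eqxx.
Qed.

Lemma reach_ind (L : E -> bool) v (P : V -> Prop) :
  P v -> (forall e, L e -> src e \in reach L v -> P (src e) -> P (tgt e)) ->
  forall x, x \in reach L v -> P x.
Proof.
move=> Pv Pstep x; rewrite inE => /connectP [p].
elim/last_ind: p x => [|p b IH] x /=; first by move=> _ ->.
rewrite rcons_path last_rcons => /andP [pp /existsP [e /and3P [Le /eqP se /eqP te]]] ->.
rewrite -te; apply: Pstep => //; last by rewrite se; apply: IH.
by rewrite inE se; apply/connectP; exists p.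
Qed.

Lemma reach_sub (L L' : E -> bool) v : (forall e, src e \in reach L v -> L e -> L' e) ->
  reach L v \subset reach L' v.
Proof.
move=> h; apply/subsetP; apply: reach_ind; first exact: reach_root.
by move=> e Le se; move/reach_step; apply; apply: h.
Qed.

Lemma reach_local (L L' : E -> bool) v : (forall e, src e \in reach L v -> L e = L' e) ->
  reach L v = reach L' v.
Proof.
move=> h; apply/eqP; rewrite eqEsubset reach_sub => [|e se Le]; last by rewrite -h.
apply/subsetP; apply: reach_ind; first exact: reach_root.
by move=> e Le' _ se; apply: reach_step => //; rewrite h.
Qed.

Lemma reach_last (L : E -> bool) v x : x \in reach L v -> x <> v ->
  exists e, [/\ L e, src e \in reach L v & tgt e = x].
Proof.
move: x; apply: reach_ind => [//|e Le se _ _]; by exists e.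
Qed.

Definition spread (s : state E) (v : V) (x : E -> bool) : {set V} :=
  reach (fun e => (e \in st_arcs s) && x e) v.

Definition row (s : state E) (M : matrix E) : {ffun E -> bool} :=
  [ffun e => M e (st_cnt s e)].

Lemma activatedE M s v : activated src tgt M s v = spread s v (row s M).
Proof. by apply: reach_local => e _; rewrite ffunE. Qed.

Lemma spread_local s v (x x' : E -> bool) :
  (forall e, e \in st_arcs s -> src e \in spread s v x -> x e = x' e) ->
  spread s v x = spread s v x'.
Proof. by move=> h; apply: reach_local => e se; case: (boolP (e \in _)) => //= /h ->. Qed.

Lemma run_rcons M y v : run M (rcons y v) = step src tgt M (run M y) v.
Proof. by rewrite /run_seq foldl_rcons. Qed.

(** Only the run on [M] decides which entries count; by [agree_run] the run on [M'] then observes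
    the same ones. *)
Definition agree (M M' : matrix E) (y : seq V) :=
  forall e j, (j < st_cnt (run M y) e)%N -> M e j = M' e j.

Lemma cnt_rcons M y v e :
  st_cnt (run M (rcons y v)) e =
  (st_cnt (run M y) e +
   ((e \in st_arcs (run M y)) && (src e \in activated src tgt M (run M y) v)))%N.
Proof. by rewrite run_rcons. Qed.

Lemma agree_rcons M M' y v : agree M M' (rcons y v) -> agree M M' y.
Proof. by move=> h e j hj; apply: h; rewrite cnt_rcons; apply: ltn_addr. Qed.

(** By induction on the rounds: an activated set is determined by the arcs leaving it, and the coins
    of these are observed in that very round. *)
Lemma agree_run M M' y : agree M M' y -> run M y = run M' y.
Proof.
elim/last_ind: y => // y v IH h; have e1 := IH (agree_rcons h).
have e2 : activated src tgt M (run M y) v = activated src tgt M' (run M y) v.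
  rewrite !activatedE; apply: spread_local => e es sA; rewrite !ffunE; apply: h.
  by rewrite cnt_rcons es activatedE sA addn1.
by rewrite !run_rcons -e1 /step -e2.
Qed.

Lemma obs_agree M M' y : obs M y = obs M' y <-> agree M M' y.
Proof.
split=> [eo e j hj | h].
  move: (congr1 (fun q : pmatrix E => q e j) eo); rewrite /partial hj.
  by case: ifP => // _ [].
apply: functional_extensionality => e; apply: functional_extensionality => j.
by rewrite /partial -(agree_run h); case: ifP => // hj; rewrite (h e j hj).
Qed.

Lemma obs_run M M' y : obs M y = obs M' y -> run M y = run M' y.
Proof. by move/obs_agree/agree_run. Qed.

Lemma obs_rcons M M' y v : obs M (rcons y v) = obs M' (rcons y v) -> obs M y = obs M' y.
Proof. by move/obs_agree/agree_rcons/obs_agree. Qed.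

Lemma cnt_size M y e : (st_cnt (run M y) e <= size y)%N.
Proof.
elim/last_ind: y => // y v IH; rewrite cnt_rcons size_rcons.
by case: (_ && _); rewrite ?addn1 ?addn0 ?ltnS // leqW.
Qed.

Lemma infl_nil M : infl M [::] = set0.
Proof. by apply/setP => x; rewrite !inE /=; apply/existsP => -[e /andP []]. Qed.

(** An activated node other than the seed is entered through a coin equal to 1 observed in this
    round; conversely a newly observed coin belongs to an arc leaving the activated set. *)
Lemma infl_rcons M y v :
  infl M (rcons y v) = infl M y :|: activated src tgt M (run M y) v.
Proof.
apply/setP => x; rewrite in_setU.
have cntS e : st_cnt (run M (rcons y v)) e = st_cnt (run M y) e \/
   [/\ e \in st_arcs (run M y), src e \in activated src tgt M (run M y) v &
    st_cnt (run M (rcons y v)) e = (st_cnt (run M y) e).+1].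
  rewrite cnt_rcons; case: (boolP (_ && _)) => [/andP [h1 h2]|_].
    by right; rewrite addn1.
  by left; rewrite addn0.
apply/idP/orP.
- rewrite inE mem_rcons in_cons => /orP [/orP [/eqP ->|xy]|/existsP [e /andP [/eqP te hh]]].
  + by right; rewrite activatedE reach_root.
  + by left; rewrite inE xy.
  move: hh; case: (cntS e) => [->|[h1 h2 ->]] hh.
    by left; rewrite inE; apply/orP; right; apply/existsP; exists e; rewrite te eqxx.
  move: hh; rewrite -addn1 iotaD has_cat add0n /= orbF => /orP [hh|hM].
    by left; rewrite inE; apply/orP; right; apply/existsP; exists e; rewrite te eqxx.
  right; rewrite -te; move: h2; rewrite !activatedE => h2; apply: reach_step => //.
  by rewrite h1 ffunE.
- case.
    rewrite !inE mem_rcons in_cons => /orP [->|/existsP [e /andP [te hh]]].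
      by rewrite orbT.
    apply/orP; right; apply/existsP; exists e; rewrite te /=.
    case: (cntS e) => [->//|[_ _ ->]].
    by rewrite -addn1 iotaD has_cat hh.
  move=> xA; rewrite inE mem_rcons in_cons; case: (eqVneq x v) => //= xv.
  have [e [/andP [ea Me] se te]] : exists e,
     [/\ (e \in st_arcs (run M y)) && M e (st_cnt (run M y) e),
         src e \in activated src tgt M (run M y) v & tgt e = x].
    by apply: reach_last => //; apply/eqP.
  apply/orP; right; apply/existsP; exists e; rewrite te eqxx /= cnt_rcons ea se addn1.
  by rewrite -addn1 iotaD has_cat /= add0n Me orbT.
Qed.

Lemma arcs_rcons M y v e : (e \in st_arcs (run M (rcons y v))) =
  (e \in st_arcs (run M y)) &&
  ~~ ((tgt e \in activated src tgt M (run M y) v) && (tgt e != v)).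
Proof. by rewrite run_rcons inE. Qed.

Lemma removed_infl M y e : e \notin st_arcs (run M y) -> tgt e \in infl M y.
Proof.
elim/last_ind: y => [|y v IH]; first by rewrite inE.
rewrite arcs_rcons infl_rcons in_setU negb_and negbK => /orP [/IH -> //|/andP [-> _]].
by rewrite orbT.
Qed.

Lemma cnt0 M y e : src e \notin infl M y -> st_cnt (run M y) e = 0%N.
Proof.
elim/last_ind: y => // y v IH; rewrite infl_rcons in_setU negb_or => /andP [/IH h1 h2].
by rewrite cnt_rcons h1 (negbTE h2) andbF.
Qed.

(** In the round that first activates the source, [e] is either present, hence observed, or already
    removed, which happens only after its target was activated. *)
Lemma infl_cnt M y e : src e \in infl M y ->
  (0 < st_cnt (run M y) e)%N || (tgt e \in infl M y).
Proof.
elim/last_ind: y => [|y v IH]; first by rewrite infl_nil inE.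
rewrite infl_rcons !in_setU => /orP [/IH /orP [h|->]|h]; rewrite ?orbT //.
  by rewrite cnt_rcons ltn_addr.
case: (boolP (e \in st_arcs (run M y))) => [he|/removed_infl -> //]; last by rewrite orbT.
by rewrite cnt_rcons he h addn1.
Qed.

Lemma infl_closed M y e : src e \in infl M y -> M e 0%N -> tgt e \in infl M y.
Proof.
move=> /infl_cnt /orP [c0 Me|//]; rewrite inE; apply/orP; right.
apply/existsP; exists e; rewrite eqxx; apply/hasP; exists 0%N => //.
by rewrite mem_iota.
Qed.

Lemma obs_infl M M' y : obs M y = obs M' y -> infl M y = infl M' y.
Proof.
move=> eo; have er := obs_run eo; move/obs_agree: eo => ag.
apply/setP => x; rewrite !inE -er; congr (_ || _).
apply: eq_existsb => e; congr (_ && _); apply: eq_in_has => j; rewrite mem_iota add0n /=.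
exact: ag.
Qed.

Lemma row_put_agree (d : E -> bool) x M y :
  agree M (row_put d (st_cnt (run M y)) x M) y.
Proof.
move=> e j hj; rewrite /row_put; case: eqP => [ej|]; last by rewrite andbF.
by move: hj; rewrite ej ltnn.
Qed.

(** * Splicing the coins of one run into another matrix *)

Definition intermediary (s : state E) (v : V) (x : E -> bool) (e : E) : bool :=
  [&& e \in st_arcs s, src e \in spread s v x & src e != v].

(* N with column 0 overwritten by the coin of M revealed when the source of the arc
   is activated as an intermediary during the run of y from s. *)
Fixpoint splice (M : matrix E) (s : state E) (y : seq V) (N : matrix E) : matrix E :=
  if y is v :: y' then
    row_put (intermediary s v (row s M)) (fun=> 0%N) (row s M)
      (splice M (step src tgt M s v) y' N)
  else N.

(** The first round is the outermost overwrite, so an appended round acts directly on [N]. *)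
Lemma splice_rcons M s y v N (t := foldl (step src tgt M) s y) :
  splice M s (rcons y v) N =
  splice M s y (row_put (intermediary t v (row t M)) (fun=> 0%N) (row t M) N).
Proof. by rewrite {}/t; elim: y s => //= u y IH s; rewrite IH. Qed.

Lemma splice_entry M s y N N' e j : N e j = N' e j -> splice M s y N e j = splice M s y N' e j.
Proof. by move=> h; elim: y s => //= u y IH s; rewrite /row_put IH. Qed.

Lemma arcs_foldl M s y e : e \in st_arcs (foldl (step src tgt M) s y) -> e \in st_arcs s.
Proof. by elim: y s => //= u y IH s /IH; rewrite inE => /andP []. Qed.

(** Had the source of [e] been an intermediary, all arcs into it, [e'] among them, would have been
    removed; so no round overwrote the coins of [e]. *)
Lemma splice_unrevealed M s y N e e' :
  e' \in st_arcs (foldl (step src tgt M) s y) -> tgt e' = src e ->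
  splice M s y N e = N e.
Proof.
elim: y s => //= u y IH s h te; rewrite -(IH _ h te).
apply: functional_extensionality => j; rewrite /row_put.
suff -> : intermediary s u (row s M) e = false by [].
apply/negP => /and3P [_ h1 h2].
move: (arcs_foldl h); rewrite inE => /andP [_]; rewrite te h2 andbT activatedE.
by rewrite h1.
Qed.

(** The overwritten entries and their new values are determined by coins observed during the run. *)
Lemma splice_agree M M' y N : agree M M' y ->
  splice M (init_state E) y N = splice M' (init_state E) y N.
Proof.
elim/last_ind: y N => // y v IH N h; have h' := agree_rcons h.
rewrite !splice_rcons -!/(run_seq _ _ _ _) -(agree_run h') IH //; congr splice.
set s := run M y.
have rw e : e \in st_arcs s -> src e \in spread s v (row s M) -> row s M e = row s M' e.
  move=> es se; rewrite !ffunE; apply: h; rewrite cnt_rcons es activatedE se.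
  by rewrite addn1.
apply: functional_extensionality => e; apply: functional_extensionality => j.
rewrite /row_put /intermediary -(spread_local rw).
by case: (boolP [&& _, _ & _]) => //= /and3P [h1 h2 _]; rewrite rw.
Qed.

End Process.

(** * Rewards, expected gains and runs of a policy *)

Section Policies.
Set Implicit Arguments.
Unset Strict Implicit.
Variables (V E : finType) (src tgt : E -> V) (w : E -> R) (r : V -> R).
Hypothesis hw : forall e, 0 <= w e <= 1.
Hypothesis hr : forall v, 0 <= r v.

Local Notation run := (run_seq src tgt).
Local Notation obs := (partial src tgt).
Local Notation infl := (influenced src tgt).
Local Notation fval := (Defs.f src tgt r).

Definition reward (A : {set V}) : R := \big[Rplus/R0]_(x in A) r x.

Lemma reward_ge0 A : 0 <= reward A.
Proof. by apply: Rsum_ge0. Qed.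

Lemma rewardU (A B : {set V}) : reward (A :|: B) = reward A + reward (B :\: A).
Proof.
rewrite /reward (big_setID A) /= setUK; congr (_ + _).
by apply: eq_bigl => x; rewrite !inE; case: (x \in A).
Qed.

Lemma reward_sub (A B : {set V}) : A \subset B -> reward A <= reward B.
Proof.
by move=> /setUidPr <-; rewrite rewardU; move: (reward_ge0 (B :\: A)); lra.
Qed.

Lemma f_rcons y v M : fval (rcons y v) M =
  fval y M + reward (spread src tgt (run M y) v (row (run M y) M) :\: infl M y).
Proof. by rewrite /Defs.f infl_rcons activatedE; apply: rewardU. Qed.

Lemma f_obs_eq y M M' : obs M y = obs M' y -> fval y M = fval y M'.
Proof. by move=> h; rewrite /Defs.f (obs_infl h). Qed.

(** Computes, with a row of unread coins, the conditional expected gain given a history with state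
    [s] and influenced set [S]; see [gainE]. *)
Definition spread_gain (s : state E) (S : {set V}) (v : V) : R :=
  row_exp w (fun x => reward (spread src tgt s v x :\: S)).

Definition max_spread_gain (s : state E) (S : {set V}) : R :=
  \big[Rmax/R0]_v spread_gain s S v.

Lemma spread_gain_ge0 s S v : 0 <= spread_gain s S v.
Proof. by apply: row_exp_ge0 => // x; apply: reward_ge0. Qed.

Lemma bigmax_ge (I : finType) (F : I -> R) i : F i <= \big[Rmax/R0]_j F j.
Proof.
rewrite /index_enum -enumT; have : i \in enum I by rewrite mem_enum.
elim: (enum I) => // j s IH; rewrite in_cons big_cons => /orP [/eqP ->|/IH h].
  exact: Rmax_l.
by apply: Rle_trans h (Rmax_r _ _).
Qed.

Lemma max_spread_gain_ge0 s S : 0 <= max_spread_gain s S.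
Proof.
apply: (big_ind (Rle 0)) => [|x y hx hy|v _]; first exact: Rle_refl.
  exact: Rle_trans hx (Rmax_l _ _).
exact: spread_gain_ge0.
Qed.

(* The entries about to be read are independent of the observed history. *)
Lemma refresh N y (H : matrix E -> {ffun E -> bool} -> R) : (size y < N)%N ->
  (forall M M' x, obs M y = obs M' y -> H M x = H M' x) ->
  Exp w N (fun M => H M (row (run M y) M)) = Exp w N (fun M => row_exp w (H M)).
Proof.
move=> yN Hobs.
transitivity (row_exp w (fun x => Exp w N (fun M => H M x))); last first.
  by rewrite /row_exp /Exp; apply: wsum_exchange.
pose d (_ : {ffun E -> bool}) (_ : matrix E) (_ : E) := true.
have agr x M : obs M y = obs (row_put (d x M) (st_cnt (run M y)) x M) y.
  by apply/obs_agree/row_put_agree.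
rewrite (@swap_row E w N d d (fun M => st_cnt (run M y)) _ _ _ (fun x M => H M x)) //.
- rewrite -[LHS](row_exp_cst w); apply: row_exp_eq => x; apply: Exp_eq => M.
  by rewrite -(Hobs _ _ _ (agr x M)); congr (H M _).
- by move=> M e; apply: leq_ltn_trans (cnt_size _ _ _ _ _) yN.
- by move=> x M e; rewrite -(obs_run (agr x M)).
Qed.

(** Outside the domain, choices get probability 0 and stopping gets 1, so every round is a
    distribution over the nodes and stopping. *)
Definition choice_prob (p : policy V E) y Mt v : R :=
  if excluded_middle_informative (pdom p y Mt) then pchoice p y Mt v else 0.
Definition stop_prob (p : policy V E) y Mt : R :=
  if excluded_middle_informative (pdom p y Mt) then 0 else 1.

(** Generalises [outcome] to any payoff [g] of the final sequence, so that gains can be averaged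
    along a run as well. *)
Fixpoint prun (p : policy V E) n y (M : matrix E) (g : seq V -> R) : R :=
  if n is n'.+1 then
    stop_prob p y (obs M y) * g y +
    \big[Rplus/R0]_v (choice_prob p y (obs M y) v * prun p n' (rcons y v) M g)
  else g y.

Lemma outcomeE p n y M : outcome src tgt r p n y M = prun p n y M (fval^~ M).
Proof.
elim: n y => //= n IH y; rewrite /stop_prob /choice_prob; case: excluded_middle_informative => h /=.
  by rewrite Rmult_0_l Rplus_0_l; apply: eq_bigr => v _; rewrite IH.
by rewrite big1 ?Monoid.mulm1 ?Rmult_1_l // => v _; apply: Rmult_0_l.
Qed.

Section Valid.
Variable p : policy V E.
Hypothesis hp : valid_policy p.

Lemma choice_prob_ge0 y Mt v : 0 <= choice_prob p y Mt v.
Proof.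
rewrite /choice_prob; case: excluded_middle_informative => h /=; last exact: Rle_refl.
by have [h0 _] := hp h.
Qed.

Lemma stop_prob_ge0 y Mt : 0 <= stop_prob p y Mt.
Proof. by rewrite /stop_prob; case: excluded_middle_informative => h /=; lra. Qed.

Lemma prob_total y Mt : stop_prob p y Mt + \big[Rplus/R0]_v choice_prob p y Mt v = 1.
Proof.
rewrite /stop_prob /choice_prob; case: excluded_middle_informative => h /=.
  by have [_ ->] := hp h; rewrite Rplus_0_l.
by rewrite big1 // Monoid.mulm1.
Qed.

Lemma prun_lin n y M a g b h :
  prun p n y M (fun z => a * g z + b * h z) = a * prun p n y M g + b * prun p n y M h.
Proof.
elim: n y => //= n IH y; under eq_bigr do rewrite IH.
rewrite !Rmult_plus_distr_l !big_distrr /=.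
under eq_bigr do rewrite Rmult_plus_distr_l.
rewrite big_split /=.
under eq_bigr do rewrite -Rmult_assoc (Rmult_comm _ a) Rmult_assoc.
under [X in _ + (_ + X)]eq_bigr do rewrite -Rmult_assoc (Rmult_comm _ b) Rmult_assoc.
lra.
Qed.

Lemma prun_le n y M g h : (forall z, g z <= h z) -> prun p n y M g <= prun p n y M h.
Proof.
move=> le; elim: n y => //= n IH y; apply: Rplus_le_compat.
  exact: Rmult_le_compat_l (stop_prob_ge0 _ _) (le _).
apply: Rsum_le => v _; apply: Rmult_le_compat_l (IH _); exact: choice_prob_ge0.
Qed.

Lemma prun_cst n y M a : prun p n y M (fun=> a) = a.
Proof.
elim: n y => //= n IH y; under eq_bigr do rewrite IH.
by rewrite -big_distrl /= -Rmult_plus_distr_r prob_total Rmult_1_l.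
Qed.


(** The recursion peels off the first round; this form splits off the last one, where the greedy
    property is applied. A run that stopped early stops again in the extra round. *)
Lemma prunS n y M g : prun p n.+1 y M g = prun p n y M (fun z => prun p 1 z M g).
Proof.
elim: n y => // n IH y.
have stop1 : stop_prob p y (obs M y) * g y = stop_prob p y (obs M y) * prun p 1 y M g.
  rewrite /= /stop_prob /choice_prob; case: excluded_middle_informative => h /=.
    by rewrite !Rmult_0_l.
  by rewrite big1 ?Monoid.mulm1 ?Rmult_1_l // => v _; apply: Rmult_0_l.
rewrite -[RHS]/(stop_prob p y (obs M y) * prun p 1 y M g +
  \big[Rplus/R0]_v (choice_prob p y (obs M y) v *
    prun p n (rcons y v) M (fun z => prun p 1 z M g))) -stop1.
by congr (_ + _); apply: eq_bigr => v _; rewrite -IH.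
Qed.

Section Expectation.
(* [Ex] is an arbitrary expectation over a space W on which Ns reads the
   realization matrix. *)
Variables (W : Type) (Ex : (W -> R) -> R) (Ns : W -> matrix E).
Hypothesis Ex_lin : forall g0 (g : V -> W -> R),
  Ex (fun t => g0 t + \big[Rplus/R0]_v g v t) = Ex g0 + \big[Rplus/R0]_v Ex (g v).
Hypothesis Ex_eq : forall g h, (forall t, g t = h t) -> Ex g = Ex h.

(** Inequalities tested against all such weights stand in for inequalities between conditional
    expectations given the history. *)
Definition observable (y : seq V) (c : W -> R) :=
  (forall t, 0 <= c t) /\ (forall t t', obs (Ns t) y = obs (Ns t') y -> c t = c t').

Lemma observable_choice y v c : observable y c ->
  observable (rcons y v) (fun t => c t * choice_prob p y (obs (Ns t) y) v).
Proof.
move=> [c0 cobs]; split=> [t|t t' /obs_rcons h]; last by rewrite h (cobs _ _ h).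
exact: Rmult_le_pos (c0 t) (choice_prob_ge0 _ _ _).
Qed.

Lemma observable_stop y c : observable y c ->
  observable y (fun t => c t * stop_prob p y (obs (Ns t) y)).
Proof.
move=> [c0 cobs]; split=> [t|t t' h]; last by rewrite h (cobs _ _ h).
exact: Rmult_le_pos (c0 t) (stop_prob_ge0 _ _).
Qed.

Lemma Ex_split y c g0 (g : V -> W -> R) :
  Ex (fun t => c t * (stop_prob p y (obs (Ns t) y) * g0 t +
    \big[Rplus/R0]_v (choice_prob p y (obs (Ns t) y) v * g v t))) =
  Ex (fun t => c t * stop_prob p y (obs (Ns t) y) * g0 t) +
  \big[Rplus/R0]_v Ex (fun t => c t * choice_prob p y (obs (Ns t) y) v * g v t).
Proof.
rewrite -Ex_lin; apply: Ex_eq => t; rewrite Rmult_plus_distr_l big_distrr /= Rmult_assoc.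
by congr (_ + _); apply: eq_bigr => v _; rewrite Rmult_assoc.
Qed.

(** Choice and stopping probabilities depend only on the history, so they are absorbed into the
    weight [c]; the comparison is then needed only at final sequences. *)
Lemma prun_exp_le (m : nat) (g h : W -> seq V -> R) :
  (forall y c, (size y <= m)%N -> observable y c ->
     Ex (fun t => c t * g t y) <= Ex (fun t => c t * h t y)) ->
  forall n y c, (size y + n <= m)%N -> observable y c ->
    Ex (fun t => c t * prun p n y (Ns t) (g t)) <= Ex (fun t => c t * prun p n y (Ns t) (h t)).
Proof.
move=> le; elim=> [|n IH] y c; first by rewrite addn0; apply: le.
move=> ym oc /=; rewrite !Ex_split; apply: Rplus_le_compat.
  by apply: le; [rewrite (leq_trans (leq_addr _ _) ym) | apply: observable_stop].
apply: Rsum_le => v _; apply: IH; last exact: observable_choice.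
by rewrite size_rcons addSnnS.
Qed.

End Expectation.
End Valid.

Lemma Exp_lin N (g0 : matrix E -> R) (g : V -> matrix E -> R) :
  Exp w N (fun M => g0 M + \big[Rplus/R0]_v g v M) =
  Exp w N g0 + \big[Rplus/R0]_v Exp w N (g v).
Proof. by rewrite !ExpE wsumD wsum_sum. Qed.

Lemma ExpD N (g h : matrix E -> R) :
  Exp w N (fun M => g M + h M) = Exp w N g + Exp w N h.
Proof. by rewrite !ExpE wsumD. Qed.

Lemma ExpZ N a (g : matrix E -> R) : Exp w N (fun M => a * g M) = a * Exp w N g.
Proof. by rewrite !ExpE wsumZ. Qed.

Lemma row_expD g h : row_exp w (fun x => g x + h x) = row_exp w g + row_exp w h.
Proof. exact: wsumD. Qed.

Lemma row_expZ a g : row_exp w (fun x => a * g x) = a * row_exp w g.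
Proof. exact: wsumZ. Qed.

Lemma row_exp_sum (g : V -> {ffun E -> bool} -> R) :
  row_exp w (fun x => \big[Rplus/R0]_v g v x) = \big[Rplus/R0]_v row_exp w (g v).
Proof. exact: wsum_sum. Qed.

Lemma row_Exp_exchange N (g : {ffun E -> bool} -> matrix E -> R) :
  row_exp w (fun x => Exp w N (g x)) = Exp w N (fun M => row_exp w (g^~ M)).
Proof. exact: wsum_exchange. Qed.

Lemma outcome_cols p n y M M' :
  (forall e j, (j < size y + n)%N -> M e j = M' e j) ->
  outcome src tgt r p n y M = outcome src tgt r p n y M'.
Proof.
elim: n y => [|n IH] y h.
  apply: f_obs_eq; apply/obs_agree => e j jc; apply: h.
  by rewrite addn0 (leq_trans jc) // cnt_size.
have o : obs M y = obs M' y.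
  apply/obs_agree => e j jc; apply: h.
  by apply: leq_trans (leq_addr _ _); apply: leq_trans jc (cnt_size _ _ _ _ _).
rewrite /= -o; case: excluded_middle_informative => _ /=; last exact: f_obs_eq.
by apply: eq_bigr => v _; rewrite (IH (rcons y v)) // size_rcons addSnnS.
Qed.

Lemma outcome_trunc p n y M : 
  outcome src tgt r (trunc p (size y + n)) n y M = outcome src tgt r p n y M.
Proof.
elim: n y => //= n IH y.
have lt : (size y < size y + n.+1)%N by rewrite addnS ltnS leq_addr.
case: excluded_middle_informative => /= h; case: excluded_middle_informative => //= h'.
- by apply: eq_bigr => v _; rewrite -IH size_rcons addSnnS.
- by case: (h' (proj1 h)).
- by case: (h (conj h' lt)).
Qed.

(** Puts truncations at different levels on one matrix space, where they can be compared. *)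
Lemma favg_truncE p n N : (n <= N)%N ->
  favg_trunc src tgt w r p n = Exp w N (outcome src tgt r p n [::]).
Proof.
move=> nN; rewrite (@Exp_cols _ w n N _ nN) => [|M M' h]; last exact: outcome_cols.
by apply: Exp_eq => M; apply: (outcome_trunc p n [::] M).
Qed.

Lemma obs_cols y M M' : (forall e j, (j < size y)%N -> M e j = M' e j) -> obs M y = obs M' y.
Proof.
move=> h; apply/obs_agree => e j jc; apply: h; exact: leq_trans jc (cnt_size _ _ _ _ _).
Qed.

Lemma ind_obs_cols y Mt (M M' : matrix E) : (forall e j, (j < size y)%N -> M e j = M' e j) ->
  Defs.ind (obs M y = Mt) = Defs.ind (obs M' y = Mt).
Proof. by move=> /obs_cols ->. Qed.

Lemma indE (P : Prop) : P -> Defs.ind P = 1.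
Proof. by rewrite /Defs.ind; case: excluded_middle_informative. Qed.

Lemma indF (P : Prop) : ~ P -> Defs.ind P = 0.
Proof. by rewrite /Defs.ind; case: excluded_middle_informative. Qed.

Lemma ind_ge0 (P : Prop) : 0 <= Defs.ind P.
Proof. by rewrite /Defs.ind; case: excluded_middle_informative => _ /=; lra. Qed.

Lemma possible_obs N (Mf : {ffun E * 'I_N -> bool}) y : (size y <= N)%N ->
  0 < weight w Mf -> possible src tgt w y (obs (ext Mf) y).
Proof.
move=> yN wpos; rewrite /possible /Pr -(Exp_cols w yN); last exact: ind_obs_cols.
rewrite ExpE /wsum (bigD1 Mf) //= indE // Rmult_1_r.
apply: Rplus_lt_le_0_compat wpos _.
by apply: Rsum_ge0 => M _; apply: Rmult_le_pos; [apply: weight_ge0 | apply: ind_ge0].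
Qed.

(** Given the history, the coins of the next round are fresh by [refresh], so only the newly reached
    reward is averaged. *)
Lemma gainE M y v : possible src tgt w y (obs M y) ->
  gain src tgt w r v y (obs M y) = spread_gain (run M y) (infl M y) v.
Proof.
rewrite /possible => pos.
(* [possible] uses [size y] columns while [gain] conditions on one column more; the probability of
   the history is the same. *)
have pos' : 0 < Pr w (size y).+1 (fun M' => obs M' y = obs M y).
  by rewrite /Pr (Exp_cols w (leqnSn (size y))) //; apply: ind_obs_cols.
have fo : f_obs src tgt r y (obs M y) = fval y M.
  apply/esym/f_obs_eq/obs_agree => e j jc.
  by rewrite /complete /partial jc.
rewrite /gain /CondExp fo.
have -> : Exp w (size y).+1 (fun M' => fval (rcons y v) M' * Defs.ind (obs M' y = obs M y)) =
  Pr w (size y).+1 (fun M' => obs M' y = obs M y) *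
  (fval y M + spread_gain (run M y) (infl M y) v); last by field; lra.
rewrite Rmult_comm /Pr -ExpZ.
pose H M' x := Defs.ind (obs M' y = obs M y) *
  (fval y M' + reward (spread src tgt (run M' y) v x :\: infl M' y)).
transitivity (Exp w (size y).+1 (fun M' => H M' (row (run M' y) M'))).
  by apply: Exp_eq => M'; rewrite f_rcons Rmult_comm.
rewrite (@refresh _ y H); first last.
- by move=> M1 M2 x o; rewrite /H (f_obs_eq o) (obs_run o) (obs_infl o) o.
- exact: ltnSn.
apply: Exp_eq => M'; rewrite /H row_expZ row_expD row_exp_cst.
rewrite -/(spread_gain _ _ _); case: (excluded_middle_informative (obs M' y = obs M y)) => o.
  by rewrite (f_obs_eq o) (obs_run o) (obs_infl o) Rmult_comm.
by rewrite (indF o) Rmult_0_l Rmult_0_r.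
Qed.

(** * Value added by one greedy round *)

Section Greedy.
Variables (alpha beta : R) (p : policy V E).
Hypothesis halpha : 1 <= alpha.
Hypothesis hp : valid_policy p.
Hypothesis hgreedy : approx_greedy src tgt w r alpha beta p.

(** Nodes whose gain is at least the maximum over [alpha] carry choice probability at least [beta],
    and the others contribute nonnegative terms. Positive weight makes the history possible. If no
    gain is positive, the maximum is 0. *)
Lemma greedy_choice N (Mf : {ffun E * 'I_N -> bool}) y (M := ext Mf) : (size y <= N)%N ->
  0 < weight w Mf ->
  beta / alpha * max_spread_gain (run M y) (infl M y) <=
  \big[Rplus/R0]_v (choice_prob p y (obs M y) v * spread_gain (run M y) (infl M y) v).
Proof.
move=> yN wpos; have pos := possible_obs yN wpos.
have gE v := gainE v pos; rewrite -/M in pos gE.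
set s := run M y in gE *; set S := infl M y in gE *; pose G v := spread_gain s S v.
have mE : max_gain src tgt w r y (obs M y) = max_spread_gain s S.
  by apply: eq_bigr => v _; rewrite gE.
have m0 := max_spread_gain_ge0 s S.
set m := max_spread_gain _ _ in mE m0 *.
have [[v0 v0pos]|none] := excluded_middle_informative (exists v, 0 < G v); last first.
  have -> : m = 0.
    apply: (big_ind (fun x => x = 0)) => // [x z -> ->|v _]; first by rewrite Rmax_left; lra.
    apply: Rle_antisym; last exact: spread_gain_ge0.
    by apply: Rnot_lt_le => h; apply: none; exists v.
  rewrite Rmult_0_r; apply: Rsum_ge0 => v _; apply: Rmult_le_pos (spread_gain_ge0 _ _ _).
  exact: choice_prob_ge0.
have [hdom _] := hgreedy pos.
have [dom hb] : pdom p y (obs M y) /\ _ := hdom (ex_intro _ v0 (eq_ind_r (Rlt 0) v0pos (gE v0))).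
apply: (@Rle_trans _ ((\big[Rplus/R0]_v (if Rle_dec (/ alpha * max_gain src tgt w r y (obs M y))
  (gain src tgt w r v y (obs M y)) then pchoice p y (obs M y) v else R0)) * (/ alpha * m))).
  rewrite /Rdiv Rmult_assoc; apply: Rmult_le_compat_r hb.
  by apply: Rmult_le_pos m0; apply/Rlt_le/Rinv_0_lt_compat; lra.
rewrite big_distrl /=; apply: Rsum_le => v _; rewrite mE gE /choice_prob.
case: excluded_middle_informative => //= h; have [h0 _] := hp h.
case: Rle_dec => hv; first exact: Rmult_le_compat_l (h0 v) hv.
by rewrite Rmult_0_l; apply: Rmult_le_pos (h0 v) (spread_gain_ge0 _ _ _).
Qed.

(** After splitting off the last round by [prunS], its new reward averages over fresh coins to the
    sum bounded in [greedy_choice]. *)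
Lemma greedy_increment N n : (n < N)%N ->
  Exp w N (outcome src tgt r p n [::]) +
  beta / alpha * Exp w N (fun M => prun p n [::] M
    (fun y => max_spread_gain (run M y) (infl M y))) <=
  Exp w N (outcome src tgt r p n.+1 [::]).
Proof.
move=> nN; rewrite -ExpZ -ExpD.
pose g M y := 1 * fval y M + beta / alpha * max_spread_gain (run M y) (infl M y).
pose h M y := prun p 1 y M (fval^~ M).
have step : forall y c, (size y <= n)%N -> observable id y c ->
    Exp w N (fun M => c M * g M y) <= Exp w N (fun M => c M * h M y).
  move=> y c ym [c0 cobs].
  pose H M x := c M * (fval y M + \big[Rplus/R0]_v (choice_prob p y (obs M y) v *
      reward (spread src tgt (run M y) v x :\: infl M y))).
  have -> : Exp w N (fun M => c M * h M y) = Exp w N (fun M => H M (row (run M y) M)).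
    apply: Exp_eq => M; congr (_ * _); rewrite /h /=.
    under eq_bigr do rewrite f_rcons Rmult_plus_distr_l.
    rewrite big_split -big_distrl /= -Rplus_assoc -Rmult_plus_distr_r.
    by rewrite (prob_total hp) Rmult_1_l.
  rewrite (@refresh _ y H); first last.
  + by move=> M M' x o; rewrite /H (f_obs_eq o) (obs_run o) (obs_infl o) (cobs _ _ o) o.
  + exact: leq_ltn_trans ym nN.
  apply: wsum_le => Mf; first exact: weight_ge0.
  move=> wpos; rewrite /H row_expZ; apply: Rmult_le_compat_l (c0 _) _.
  rewrite row_expD row_exp_cst row_exp_sum /g Rmult_1_l; apply: Rplus_le_compat_l.
  under eq_bigr do rewrite row_expZ.
  apply: greedy_choice wpos; exact: leq_trans ym (ltnW nN).
have := prun_exp_le hp (@Exp_lin N) (@Exp_eq _ w N) step (y := [::]) (leqnn n) (c := fun=> 1).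
move=> /(_ (conj (fun=> Rle_0_1) (fun _ _ _ => erefl))) le.
apply: Rle_trans (Rle_trans _ _ _ le _); apply: Req_le; apply: Exp_eq => M.
  by rewrite Rmult_1_l (@prun_lin p) outcomeE Rmult_1_l.
by rewrite Rmult_1_l outcomeE prunS.
Qed.

End Greedy.
End Policies.

(** * Coupling of a run of [pistar] with a run of [pi] *)

Section Coupling.
Set Implicit Arguments.
Unset Strict Implicit.
Variables (V E : finType) (src tgt : E -> V) (w : E -> R) (r : V -> R).
Hypothesis hw : forall e, 0 <= w e <= 1.
Hypothesis hr : forall v, 0 <= r v.

Local Notation run := (run_seq src tgt).
Local Notation obs := (partial src tgt).
Local Notation infl := (influenced src tgt).
Local Notation fval := (Defs.f src tgt r).
Local Notation reward := (reward r).
Local Notation spread := (spread src tgt).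
Local Notation reach := (reach src tgt).
Local Notation mgain := (max_spread_gain src tgt w r).
Local Notation splice0 M y := (splice src tgt M (init_state E) y).

(* Coins of the coupled round of [pistar] seeding v: fresh for the seed, those of the
   matrix of [pi] for the intermediaries. *)
Definition hybrid (v : V) (x : {ffun E -> bool}) (N : matrix E) (e : E) : bool :=
  if src e == v then x e else N e 0%N.

Definition outer_reach (s : state E) (S : {set V}) (v : V) (x : E -> bool) : {set V} :=
  reach (fun e => [&& e \in st_arcs s, tgt e \notin S & x e]) v.

(* A path leaving S through an intermediary would use a coin of column 0, revealed to
   [pi] when it activated that node, and so could not leave S by [infl_closed]. *)
Lemma hybrid_spread M y v x N z (K := splice0 M y N) :
  spread (run M y) v (hybrid v x N) :\: infl K z \subset
  outer_reach (run M y) (infl K z) v (hybrid v x N) :\: infl K z.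
Proof.
set S := infl K z; set s := run M y; set O := outer_reach _ _ _ _.
suff h u : u \in spread s v (hybrid v x N) ->
    u = v \/ (u \in S \/ u \in O) /\ exists2 e, e \in st_arcs s & tgt e = u.
  apply/subsetP => u; rewrite !in_setD => /andP [uS /h []].
    by move=> uv; rewrite uS uv reach_root.
  by case; case=> [|->]; [rewrite (negbTE uS) | rewrite uS].
move: u; apply: reach_ind; first by left.
move=> e /andP [es xe] _ h; right; split; last by exists e.
case: (boolP (tgt e \in S)) => [|teS]; [by left | right].
have Ostep : src e \in O -> tgt e \in O by move=> h'; apply: reach_step => //; rewrite es teS.
case: h => [sv|[[sS|sO] [e' e's te']]]; [ | | exact: Ostep].
  by apply: Ostep; rewrite sv reach_root.
case: (eqVneq (src e) v) => [sv|sv]; first by apply: Ostep; rewrite sv reach_root.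
case/negP: teS; apply: infl_closed sS _.
by rewrite /K (splice_unrevealed _ e's te'); move: xe; rewrite /hybrid (negbTE sv).
Qed.

(** An arc whose target is not influenced has never been removed, so every arc used on the left is
    still in the graph after [y]. *)
Lemma outer_reach_spread M y (s : state E) v x :
  outer_reach s (infl M y) v x \subset spread (run M y) v x.
Proof.
apply: reach_sub => e _ /and3P [_ h ->]; rewrite andbT.
by apply/negPn/negP => /removed_infl; apply/negP.
Qed.

(** After the exchange, column 0 holds the coins of [x] for the intermediaries while the seed keeps
    its own, so the hybrid coins equal [x] on all present arcs leaving the spread. *)
Lemma hybrid_swap s v (x : {ffun E -> bool}) N (d := intermediary src tgt s v x)
    (c : E -> nat := fun=> 0%N) :
  spread s v (hybrid v (row_get d c x N) (row_put d c x N)) = spread s v x.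
Proof.
apply/esym/spread_local => e es se; rewrite /hybrid ffunE /row_put /d /intermediary es se /=.
by case: (eqVneq (src e) v).
Qed.

Section CouplingStep.
Variables (N : nat) (p : policy V E) (i : nat).
Hypothesis N_gt0 : (0 < N)%N.
Hypothesis hp : valid_policy p.

(** Potential of the coupling: [S'] is the set influenced by [pistar] so far, [n] its number of
    rounds left, each charged one maximal gain, and [K] the matrix read by [pi]. *)
Definition bound (n : nat) (S' : {set V}) (K : matrix E) : R :=
  prun src tgt p i [::] K (fun z =>
    reward (infl K z :|: S') + INR n * mgain (run K z) (infl K z)).

Let Ex2 (g : {ffun E -> bool} * matrix E -> R) : R :=
  row_exp w (fun x => Exp w N (fun K => g (x, K))).

Let Ex2_lin (g0 : {ffun E -> bool} * matrix E -> R) (g : V -> _ -> R) :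
  Ex2 (fun t => g0 t + \big[Rplus/R0]_v g v t) = Ex2 g0 + \big[Rplus/R0]_v Ex2 (g v).
Proof.
rewrite /Ex2 -row_exp_sum -row_expD; apply: row_exp_eq => x; exact: Exp_lin.
Qed.

Let Ex2_eq g h : (forall t, g t = h t) -> Ex2 g = Ex2 h.
Proof. by move=> e; apply: row_exp_eq => x; apply: Exp_eq. Qed.

Let Ex2_le g h : (forall t, g t <= h t) -> Ex2 g <= Ex2 h.
Proof. by move=> e; apply: row_exp_le => // x; apply: Exp_le. Qed.

(** The column 0 coins leaving uninfluenced nodes are unread by [pi], so exchanging them with the
    row keeps the history and the weight [c]. On the outer reach all coins then come from the fresh
    row, and the average is at most the gain of [v]. *)
Lemma fresh_gain M y v z c (Ns := fun t : {ffun E -> bool} * matrix E => splice0 M y t.2) :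
  observable src tgt Ns z c ->
  Ex2 (fun t => c t * reward (outer_reach (run M y) (infl (Ns t) z) v (hybrid v t.1 t.2)
                                :\: infl (Ns t) z)) <=
  Ex2 (fun t => c t * mgain (run (Ns t) z) (infl (Ns t) z)).
Proof.
move=> [c0 cobs]; set s := run M y.
pose x0 : {ffun E -> bool} := [ffun=> false].
have cx x K : c (x, K) = c (x0, K) by apply: cobs.
pose d (_ : {ffun E -> bool}) (K : matrix E) e :=
  (src e != v) && (src e \notin infl (Ns (x0, K)) z).
pose col (_ : matrix E) (_ : E) := 0%N.
have agr x K : obs (splice0 M y K) z = obs (splice0 M y (row_put (d x K) (col K) x K)) z.
  apply/obs_agree => e j je; apply: splice_entry.
  rewrite /row_put /d /col; case: (eqVneq j 0%N) => [j0|_]; last by rewrite andbF.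
  rewrite andbT; case: andP => [[_ /cnt0 h]|] //.
  by move: je; rewrite h.
have d_put x K : d (row_get (d x K) (col K) x K) (row_put (d x K) (col K) x K) =1 d x K.
  by move=> e; rewrite /d /Ns /= -(obs_infl (agr x K)).
rewrite /Ex2 (@swap_row E w N d d col _ _ _ (fun x K => c (x, K) * reward
   (outer_reach s (infl (Ns (x, K)) z) v (hybrid v x K) :\: infl (Ns (x, K)) z))) //.
rewrite [X in _ <= X]row_Exp_exchange [X in X <= _]row_Exp_exchange.
apply: Exp_le => // K.
apply: (@Rle_trans _ (c (x0, K) * spread_gain src tgt w r (run (Ns (x0, K)) z) (infl (Ns (x0, K)) z) v)).
  rewrite /spread_gain -row_expZ; apply: row_exp_le => // x.
  set x' := row_get _ _ _ _; set K' := row_put _ _ _ _.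
  have o : obs (Ns (x', K')) z = obs (Ns (x0, K)) z by rewrite /Ns /= -agr.
  rewrite (obs_infl o) (cobs _ _ o); apply: Rmult_le_compat_l (c0 _) _.
  apply: reward_sub => //; apply: setSD.
  have -> : outer_reach s (infl (Ns (x0, K)) z) v (hybrid v x' K') =
            outer_reach s (infl (Ns (x0, K)) z) v x.
    apply/esym/reach_local => e se; congr [&& _, _ & _].
    rewrite /hybrid ffunE /K' /row_put /d; case: (eqVneq (src e) v) => //= sv.
    (* A source other than [v] was entered by an arc with target outside the influenced set, so its
       coin has been exchanged for that of [x]. *)
    have [e' [/and3P [_ h _] _ <-]] := reach_last se (elimN eqP sv).
    by rewrite h.
  exact: outer_reach_spread.
have -> : row_exp w (fun x => c (x, K) * mgain (run (Ns (x, K)) z) (infl (Ns (x, K)) z)) =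
    c (x0, K) * mgain (run (Ns (x0, K)) z) (infl (Ns (x0, K)) z).
  by rewrite -[RHS](row_exp_cst w); apply: row_exp_eq => x; rewrite cx.
apply: Rmult_le_compat_l (c0 _) _; exact: bigmax_ge.
Qed.

(** Exchanging the intermediary coins of [x] with column 0 of [K] returns the matrix of [pi] to the
    previous splice and makes the spread of [pistar] a hybrid one. The reward this spread adds is
    bounded by [fresh_gain] and paid for by passing from [n] to [n + 1]. *)
Lemma coupling_step M y v n S' (s := run M y) :
  row_exp w (fun x => Exp w N (fun K => bound n (S' :|: spread s v x)
    (splice0 M y (row_put (intermediary src tgt s v x) (fun=> 0%N) x K)))) <=
  Exp w N (fun K => bound n.+1 S' (splice0 M y K)).
Proof.
pose H x K := bound n (S' :|: spread s v (hybrid v x K)) (splice0 M y K).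
pose d (x : {ffun E -> bool}) (_ : matrix E) := intermediary src tgt s v x.
pose d' (x : {ffun E -> bool}) K := intermediary src tgt s v (hybrid v x K).
pose col (_ : matrix E) (_ : E) := 0%N.
have -> : row_exp w (fun x => Exp w N (fun K => bound n (S' :|: spread s v x)
    (splice0 M y (row_put (intermediary src tgt s v x) (fun=> 0%N) x K)))) =
  row_exp w (fun x => Exp w N (H x)).
  have d'd x K e : d' (row_get (d x K) (col K) x K) (row_put (d x K) (col K) x K) e = d x K e.
    by rewrite /d' /intermediary hybrid_swap.
  rewrite [RHS](@swap_row E w N d d' col (fun _ _ => N_gt0) (fun _ _ _ => erefl) d'd H).
  by apply: row_exp_eq => x; apply: Exp_eq => K; rewrite /H hybrid_swap.
(* A dummy row on the right puts both sides on the space of pairs of a row and a matrix. *)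
rewrite -[X in _ <= X](row_exp_cst w).
pose Ns (t : {ffun E -> bool} * matrix E) := splice0 M y t.2.
pose g (t : {ffun E -> bool} * matrix E) z :=
  reward (infl (Ns t) z :|: (S' :|: spread s v (hybrid v t.1 t.2))) +
  INR n * mgain (run (Ns t) z) (infl (Ns t) z).
pose h (t : {ffun E -> bool} * matrix E) z := reward (infl (Ns t) z :|: S') +
  INR n.+1 * mgain (run (Ns t) z) (infl (Ns t) z).
have step z c : (size z <= i)%N -> observable src tgt Ns z c ->
    Ex2 (fun t => c t * g t z) <= Ex2 (fun t => c t * h t z).
  move=> _ oc; have [c0 _] := oc.
  pose A t := reward (infl (Ns t) z :|: S') + INR n * mgain (run (Ns t) z) (infl (Ns t) z).
  have D (a b : {ffun E -> bool} * matrix E -> R) :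
     Ex2 (fun t => a t + b t) = Ex2 a + Ex2 b.
    by rewrite /Ex2 -row_expD; apply: row_exp_eq => x; apply: ExpD.
  apply: (@Rle_trans _ (Ex2 (fun t => c t * A t + c t * reward
    (outer_reach s (infl (Ns t) z) v (hybrid v t.1 t.2) :\: infl (Ns t) z)))).
    apply: Ex2_le => t; rewrite -Rmult_plus_distr_l; apply: Rmult_le_compat_l (c0 t) _.
    rewrite /g /A setUA rewardU.
    suff : reward (spread s v (hybrid v t.1 t.2) :\: (infl (Ns t) z :|: S')) <=
      reward (outer_reach s (infl (Ns t) z) v (hybrid v t.1 t.2) :\: infl (Ns t) z) by lra.
    apply: reward_sub => //; apply: subset_trans (hybrid_spread _ _ _ _ _ _).
    exact/setDS/subsetUl.
  rewrite D; have := fresh_gain v oc; rewrite -/s => fg.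
  apply: Rle_trans (Rplus_le_compat_l _ _ _ fg) _; rewrite -D; apply: Req_le.
  by apply: Ex2_eq => t; rewrite /h /A S_INR; set b := mgain _ _; set e := reward _; ring.
have := prun_exp_le hp Ex2_lin Ex2_eq step (y := [::]) (leqnn i) (c := fun=> 1).
move=> /(_ (conj (fun=> Rle_0_1) (fun _ _ _ => erefl))) le.
by apply: Rle_trans (Rle_trans _ _ _ le _); apply: Req_le;
  apply: row_exp_eq => x; apply: Exp_eq => K; rewrite Rmult_1_l.
Qed.

End CouplingStep.

Lemma bound_ge N p i n S' M y : valid_policy p ->
  reward S' <= Exp w N (fun K => bound p i n S' (splice0 M y K)).
Proof.
move=> hp; rewrite -[X in X <= _](Exp_cst w N); apply: Exp_le => // K.
rewrite -[X in X <= _](prun_cst src tgt hp i [::] (splice0 M y K)); apply: prun_le => // z.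
have h1 : reward S' <= reward (infl (splice0 M y K) z :|: S') by apply: reward_sub (subsetUr _ _).
have h2 : 0 <= INR n * mgain (run (splice0 M y K) z) (infl (splice0 M y K) z).
  by apply: Rmult_le_pos (pos_INR n) _; apply: max_spread_gain_ge0.
lra.
Qed.

Section Comparison.
Variables (N : nat) (p q : policy V E) (i : nat).
Hypotheses (hp : valid_policy p) (hq : valid_policy q).

(** Induction on the rounds left to [q]: [refresh] replaces the coins read next by a fresh row, and
    [coupling_step] trades the spread of the round for one maximal gain. If [q] stops, [bound_ge]
    suffices. *)
Lemma outcome_le_bound n y c : (size y + n < N)%N -> observable src tgt id y c ->
  Exp w N (fun M => c M * outcome src tgt r q n y M) <=
  Exp w N (fun M => c M * Exp w N (fun K => bound p i n (infl M y) (splice0 M y K))).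
Proof.
have Ele m z b : observable src tgt id z b ->
    Exp w N (fun M => b M * fval z M) <=
    Exp w N (fun M => b M * Exp w N (fun K => bound p i m (infl M z) (splice0 M z K))).
  move=> [b0 _]; apply: Exp_le => // M; apply: Rmult_le_compat_l (b0 M) _.
  exact: bound_ge.
elim: n y c => [|n IH] y c yN oc; first exact: Ele.
have Esplit := @Ex_split V E src tgt q (matrix E) (Exp w N) id (@Exp_lin V E w N) (@Exp_eq E w N) y c.
have -> : Exp w N (fun M => c M * outcome src tgt r q n.+1 y M) =
    Exp w N (fun M => c M * stop_prob q y (obs M y) * fval y M) +
    \big[Rplus/R0]_v Exp w N (fun M => c M * choice_prob q y (obs M y) v *
                               outcome src tgt r q n (rcons y v) M).
  rewrite -Esplit; apply: Exp_eq => M; rewrite outcomeE /=; congr (_ * (_ + _)).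
  by apply: eq_bigr => v _; rewrite outcomeE.
pose B M := Exp w N (fun K => bound p i n.+1 (infl M y) (splice0 M y K)).
have -> : Exp w N (fun M => c M * B M) =
    Exp w N (fun M => c M * stop_prob q y (obs M y) * B M) +
    \big[Rplus/R0]_v Exp w N (fun M => c M * choice_prob q y (obs M y) v * B M).
  rewrite -Esplit; apply: Exp_eq => M; congr (_ * _).
  by rewrite -big_distrl /= -Rmult_plus_distr_r (prob_total hq) Rmult_1_l.
apply: Rplus_le_compat; first exact: Ele (observable_stop q oc).
apply: Rsum_le => v _; have oc' := observable_choice hq v oc.
apply: Rle_trans (IH _ _ _ oc') _; first by rewrite size_rcons addSnnS.
have [c0 cobs] := oc.
pose H M (x : {ffun E -> bool}) := c M * choice_prob q y (obs M y) v * Exp w N (fun K =>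
  bound p i n (infl M y :|: spread (run M y) v x)
   (splice0 M y (row_put (intermediary src tgt (run M y) v x) (fun=> 0%N) x K))).
apply: (@Rle_trans _ (Exp w N (fun M => H M (row (run M y) M)))).
  apply: Req_le; apply: Exp_eq => M; apply: Rmult_eq_compat_l; apply: Exp_eq => K.
  by rewrite infl_rcons activatedE splice_rcons.
have Hobs M M' x : obs M y = obs M' y -> H M x = H M' x.
  move=> o; rewrite /H (obs_run o) (obs_infl o) o (cobs _ _ o).
  apply: Rmult_eq_compat_l; apply: Exp_eq => K.
  by rewrite (splice_agree _ (proj1 (obs_agree _ _ _ _ _) o)).
apply: (Rle_trans _ _ _ (Req_le _ _ (refresh w (leq_ltn_trans (leq_addr _ _) yN) Hobs))).
apply: Exp_le => // M; rewrite /H row_expZ; apply: Rmult_le_compat_l.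
  exact: Rmult_le_pos (c0 M) (choice_prob_ge0 hq _ _ _).
by apply: coupling_step => //; apply: leq_trans yN.
Qed.

(** At the empty history nothing is influenced or spliced, so the potential is the value of [p] plus
    [k] maximal gains. *)
Lemma outcome_comparison k : (k < N)%N ->
  Exp w N (outcome src tgt r q k [::]) <=
  Exp w N (outcome src tgt r p i [::]) +
  INR k * Exp w N (fun M => prun src tgt p i [::] M (fun z => mgain (run M z) (infl M z))).
Proof.
move=> kN.
have := @outcome_le_bound k [::] (fun=> 1) kN (conj (fun=> Rle_0_1) (fun _ _ _ => erefl)).
under Exp_eq do rewrite Rmult_1_l.
move=> le; apply: Rle_trans le _.
under Exp_eq do rewrite Rmult_1_l infl_nil /=.
rewrite Exp_cst -ExpZ -ExpD; apply: Req_le; apply: Exp_eq => K.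
rewrite outcomeE /bound -[X in _ = X + _]Rmult_1_l -prun_lin.
congr prun; apply: functional_extensionality => z.
by rewrite setU0 Rmult_1_l.
Qed.

End Comparison.
End Coupling.

(** * Geometric decay of the gap and conclusion *)

Lemma pow_le_exp (t : R) (n : nat) : 0 <= 1 - t -> (1 - t) ^ n <= exp (- (t * INR n)).
Proof.
move=> t1; elim: n => [|n IH]; first by rewrite Rmult_0_r Ropp_0 exp_0; apply: Rle_refl.
rewrite S_INR [_ ^ _]/= (_ : - (t * (INR n + 1)) = - t + - (t * INR n)); last by ring.
rewrite exp_plus; apply: Rmult_le_compat => //; first exact: pow_le.
by move: (exp_ineq1_le (- t)); lra.
Qed.

(** The two hypotheses combine to [opt - a i.+1 <= (1 - t) * (opt - a i)], and
    [1 - t <= exp (- t)]. *)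
Lemma geometric_gap (a b : nat -> R) (opt t : R) (n : nat) :
  0 <= a 0%N -> 0 <= opt -> 0 <= t <= 1 ->
  (forall i, (i < n)%N -> a i + t * b i <= a i.+1) ->
  (forall i, (i < n)%N -> opt <= a i + b i) ->
  (1 - exp (- (t * INR n))) * opt <= a n.
Proof.
move=> a0 opt0 t01 inc gap.
suff h : opt - a n <= (1 - t) ^ n * opt.
  have := Rmult_le_compat_r _ _ _ opt0 (@pow_le_exp t n ltac:(lra)); lra.
elim: n inc gap => [|n IH] inc gap; first by rewrite /=; lra.
have := IH (fun i h => inc i (ltnW h)) (fun i h => gap i (ltnW h)).
have h1 := inc n (ltnSn n); have h2 := gap n (ltnSn n).
move=> h3; rewrite /= Rmult_assoc.
have : (1 - t) * (opt - a n) <= (1 - t) * ((1 - t) ^ n * opt).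
  by apply: Rmult_le_compat_l h3; lra.
have : t * (opt - a n) <= t * b n by apply: Rmult_le_compat_l; lra.
lra.
Qed.

Theorem theorem3 (V E : finType) (src tgt : E -> V)
  (simple : injective (fun e => (src e, tgt e)))
  (w : E -> R) (hw : forall e, (0 <= w e <= 1))
  (r : V -> R) (hr : forall v, (0 <= r v))
  (alpha beta : R) (halpha : (1 <= alpha)) (hbeta : (0 < beta <= 1))
  (pi pistar : policy V E)
  (hpi : valid_policy pi) (hgreedy : approx_greedy src tgt w r alpha beta pi)
  (hpistar : valid_policy pistar)
  (l k : nat) (hl : (0 < l)%N) (hk : (0 < k)%N) :
  (favg_trunc src tgt w r pi l >=
   (1 - exp (- (beta * INR l) / (alpha * INR k))) * favg_trunc src tgt w r pistar k).
Proof.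
(* One matrix width for both policies, strictly above [l] and [k]: [greedy_increment] and
   [outcome_comparison] ask for a column beyond the rounds they count. *)
pose N := (l + k).+1.
have lN : (l < N)%N by rewrite ltnS leq_addr.
have kN : (k < N)%N by rewrite ltnS leq_addl.
have k1 : 1 <= INR k by rewrite -[1]/(INR 1); apply/le_INR/leP.
rewrite (favg_truncE src tgt w r pi (ltnW lN)) (favg_truncE src tgt w r pistar (ltnW kN)).
pose b i := INR k * Exp w N (fun M => prun src tgt pi i [::] M (fun y =>
  max_spread_gain src tgt w r (run_seq src tgt M y) (influenced src tgt M y))).
(* With this rate, [t * b i] is [beta / alpha] times the expected maximal gain, which is the
   increment of [greedy_increment]. *)
pose t := beta / (alpha * INR k).
have ak1 : 1 <= alpha * INR k by rewrite -[1]Rmult_1_r; apply: Rmult_le_compat; lra.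
have t01 : 0 <= t <= 1.
  split; first by apply: Rle_mult_inv_pos; lra.
  apply: (Rmult_le_reg_r (alpha * INR k)); first lra.
  by rewrite Rmult_1_l (_ : t * _ = beta); [lra | rewrite /t; field; lra].
have ge0 p n : valid_policy p -> 0 <= Exp w N (outcome src tgt r p n [::]).
  move=> hp; rewrite -(Exp_cst w N 0); apply: Exp_le => // M.
  rewrite outcomeE -(prun_cst src tgt hp n [::] M 0); apply: prun_le => // y.
  exact: reward_ge0.
apply: Rle_ge; rewrite (_ : - (beta * INR l) / (alpha * INR k) = - (t * INR l)); last first.
  by rewrite /t; field; lra.
apply: (@geometric_gap (fun i => Exp w N (outcome src tgt r pi i [::])) b) => //; try exact: ge0.
- move=> i il; have := greedy_increment hw hr halpha hpi hgreedy (ltn_trans il lN).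
  rewrite /b /t; set e := Exp w N (fun M => prun _ _ _ _ _ _ _).
  by rewrite (_ : beta / (alpha * INR k) * (INR k * e) = beta / alpha * e); last by field; lra.
- by move=> i _; apply: outcome_comparison.
Qed.
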